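(* Let $n\geqslant 2$ be an integer and let $\alpha\in(0,2]$, $\alpha<n$. For any $\xi\in\mathfrak{M}$ with $\xi^+(\mathbb{R}^n)>\xi^-(\mathbb{R}^n)$, the inequality $\kappa_\alpha\xi>0$ holds true everywhere on $\mathbb{R}^n$, except for a subset that is inner $\alpha$-thin at infinity.
   Context: Kernel and potential: $\kappa_\alpha(x,y):=|x-y|^{\alpha-n}$ is the $\alpha$-Riesz kernel on $\mathbb{R}^n$ ($|x-y|$ the Euclidean distance, $\kappa_\alpha(x,x)=+\infty$). For a positive Radon measure $\mu$ on $\mathbb{R}^n$, $\kappa_\alpha\mu(x):=\int\kappa_\alpha(x,y)\,d\mu(y)\in[0,+\infty]$. $\mathfrak{M}^+$ is the cone of all positive Radon measures $\mu$ on $\mathbb{R}^n$ (possibly with $\mu(\mathbb{R}^n)=+\infty$) such that $\kappa_\alpha\mu$ is not identically $+\infty$; equivalently, $\int_{|y|>1}|y|^{\alpha-n}\,d\mu(y)<\infty$. Signed measures: $\mathfrak{M}$ is the linear space of all real-valued (signed) Radon measures $\xi$ on $\mathbb{R}^n$ such that $\int_{|y|>1}|y|^{\alpha-n}\,d|\xi|(y)<\infty$, where $|\xi|:=\xi^++\xi^-$ and $\xi^+,\xi^-$ are the positive and negative parts of $\xi$ in the Hahn–Jordan decomposition; the masses $\xi^\pm(\mathbb{R}^n)$ lie in $[0,+\infty]$. The potential is $\kappa_\alpha\xi:=\kappa_\alpha\xi^+-\kappa_\alpha\xi^-$; it is well defined and finite nearly everywhere on $\mathbb{R}^n$, and points where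 it is not well defined (both terms $+\infty$) are counted as points where $\kappa_\alpha\xi>0$ fails. Inner capacity: a measure $\mu\in\mathfrak{M}^+$ is concentrated on $A\subset\mathbb{R}^n$ if $A^c:=\mathbb{R}^n\setminus A$ is $\mu$-negligible. Let $\mathcal{E}^+_A$ be the set of all $\mu\in\mathfrak{M}^+$ concentrated on $A$ with finite energy $\kappa_\alpha(\mu,\mu):=\int\kappa_\alpha(x,y)\,d(\mu\otimes\mu)(x,y)<\infty$. The inner $\alpha$-Riesz capacity of an arbitrary $A\subset\mathbb{R}^n$ is $c_\alpha(A):=1/\inf\kappa_\alpha(\mu,\mu)$, the infimum being over all $\mu\in\mathcal{E}^+_A$ with $\mu(\mathbb{R}^n)=1$, with the conventions $\inf\varnothing=+\infty$, $1/(+\infty)=0$, $1/0=+\infty$. A property holds nearly everywhere (n.e.) on $A$ if the set $E$ of all $x\in A$ where it fails satisfies $c_\alpha(E)=0$. Inner $\alpha$-thinness at infinity: $A\subset\mathbb{R}^n$ is inner $\alpha$-thin at infinity if for some (equivalently, every) $y\in\mathbb{R}^n$, $$\sum_{j\in\mathbb{N}}\frac{c_\alpha(A_j)}{q^{j(n-\alpha)}}<\infty,\qquad\text{where } q\in(1,\infty)\text{ and }A_j:=A\cap\{x\in\mathbb{R}^n: q^j\leqslant|x-y|<q^{j+1}\}.$$ Equivalently, there exist $\nu\in\mathfrak{M}^+$ and a constant $c>0$ with $\kappa_\alpha\nu\geqslant c$ n.e. on $A$. *)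

(* Defs.v *)
From mathcomp Require Import all_boot all_order all_algebra.
From mathcomp Require Import all_classical all_reals all_analysis.
Set Implicit Arguments.
Unset Strict Implicit.
Unset Printing Implicit Defensive.
Import Order.TTheory GRing.Theory Num.Theory.
Import numFieldNormedType.Exports.
Local Open Scope classical_set_scope.
Local Open Scope ring_scope.
Local Open Scope ereal_scope.

(* R^n with its Borel sigma-algebra. The topology of 'rV[R]_n is the product
   topology, but its library norm `|x| is the sup norm: Euclidean distances are
   always taken with [enorm] below. *)
Notation borelRn R n := (g_sigma_algebraType (@open 'rV[R]_n)).

Definition enorm (R : realType) (n : nat) (x : 'rV[R]_n) : R :=
  Num.sqrt (\sum_(i < n) x ord0 i ^+ 2)%R.

(* The case x = y is separate because 0 `^ a = 0 for a < 0 in the library. *)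
Definition riesz_kernel (R : realType) (n : nat) (alpha : R) (x y : 'rV[R]_n)
    : \bar R :=
  if x == y then +oo else (enorm (x - y) `^ (alpha - n%:R))%:E.

Definition potential (R : realType) (n : nat) (alpha : R)
    (mu : {measure set (borelRn R n) -> \bar R}) (x : 'rV[R]_n) : \bar R :=
  \int[mu]_y riesz_kernel alpha x y.

Definition energy (R : realType) (n : nat) (alpha : R)
    (mu : {measure set (borelRn R n) -> \bar R}) : \bar R :=
  \int[mu \x mu]_z riesz_kernel alpha z.1 z.2.

(* On R^n, Radon measures are the Borel measures that are finite on compact
   sets; inner and outer regularity are then automatic. *)
Definition radon (R : realType) (n : nat)
    (mu : {measure set (borelRn R n) -> \bar R}) : Prop :=
  forall K : set 'rV[R]_n, compact K -> mu K < +oo.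

Definition frakMplus (R : realType) (n : nat) (alpha : R)
    (mu : {measure set (borelRn R n) -> \bar R}) : Prop :=
  radon mu /\ exists x : 'rV[R]_n, potential alpha mu x < +oo.

Definition relatively_compact (R : realType) (n : nat) (B : set 'rV[R]_n)
    : Prop :=
  exists2 K : set 'rV[R]_n, compact K & B `<=` K.

(* A signed Radon measure on R^n is real-valued and countably additive on the
   relatively compact Borel sets; it need not extend to all Borel sets, and its
   values elsewhere are irrelevant. Taking F constantly empty gives
   xi set0 = 0. *)
Definition signed_radon (R : realType) (n : nat)
    (xi : set (borelRn R n) -> R) : Prop :=
  forall F : (set (borelRn R n))^nat,
    (forall i, measurable (F i)) -> trivIset setT F ->
    relatively_compact (\bigcup_i F i) ->
    (\sum_(0 <= i < k) xi (F i))%R @[k --> \oo] --> xi (\bigcup_i F i).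

(* (xip, xim) is the Hahn-Jordan decomposition (xi^+, xi^-) of xi; the set P is
   the positive set of the Hahn decomposition. *)
Definition hahn_jordan (R : realType) (n : nat)
    (xi : set (borelRn R n) -> R)
    (xip xim : {measure set (borelRn R n) -> \bar R}) : Prop :=
  [/\ radon xip, radon xim,
      exists P : set (borelRn R n),
        [/\ measurable P, xip (~` P) = 0 & xim P = 0]
    & forall B : set (borelRn R n), measurable B -> relatively_compact B ->
        (xi B)%:E = xip B - xim B].

Definition frakM (R : realType) (n : nat) (alpha : R)
    (xi : set (borelRn R n) -> R)
    (xip xim : {measure set (borelRn R n) -> \bar R}) : Prop :=
  [/\ signed_radon xi, hahn_jordan xi xip xim
    & \int[measure_add xip xim]_(y in [set y : borelRn R n |
          (1 < enorm (y : 'rV[R]_n))%R])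
        (enorm (y : 'rV[R]_n) `^ (alpha - n%:R))%:E < +oo].

(* +? excludes the indeterminate form +oo - +oo, where the library's total
   subtraction has a junk value. *)
Definition signed_potential_gt0 (R : realType) (n : nat) (alpha : R)
    (xip xim : {measure set (borelRn R n) -> \bar R}) (x : 'rV[R]_n) : Prop :=
  potential alpha xip x +? - potential alpha xim x /\
  0 < potential alpha xip x - potential alpha xim x.

Definition concentrated_on (R : realType) (n : nat)
    (mu : {measure set (borelRn R n) -> \bar R}) (A : set 'rV[R]_n) : Prop :=
  mu.-negligible (~` A).

Definition frakEplus (R : realType) (n : nat) (alpha : R) (A : set 'rV[R]_n)
    (mu : {measure set (borelRn R n) -> \bar R}) : Prop :=
  [/\ frakMplus alpha mu, concentrated_on mu A & energy alpha mu < +oo].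

(* In \bar R, ereal_inf set0 = +oo, 0^-1 = +oo and (+oo)^-1 = 0. *)
Definition inner_capacity (R : realType) (n : nat) (alpha : R)
    (A : set 'rV[R]_n) : \bar R :=
  (ereal_inf [set e : \bar R |
     exists mu : {measure set (borelRn R n) -> \bar R},
       [/\ frakEplus alpha A mu, mu setT = 1 & e = energy alpha mu]])^-1.

Definition annulus (R : realType) (n : nat) (q : R) (y : 'rV[R]_n) (j : nat)
    : set 'rV[R]_n :=
  [set x | (q ^+ j <= enorm (x - y) < q ^+ j.+1)%R].

(* Meaningful for q > 1; the notion then depends neither on q nor on y. *)
Definition inner_thin_at_infinity (R : realType) (n : nat) (alpha q : R)
    (A : set 'rV[R]_n) : Prop :=
  exists y : 'rV[R]_n,
    \sum_(0 <= j <oo) (inner_capacity alpha (A `&` annulus q y j) /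
                       (q `^ (j%:R * (n%:R - alpha)))%:E) < +oo.

(* Main.v *)
From HB Require Import structures.
Require Import Defs.
From mathcomp Require Import all_boot all_order all_algebra.
From mathcomp Require Import all_classical all_reals all_analysis.
From mathcomp Require Import measurable_realfun ring lra.
Import Order.TTheory GRing.Theory Num.Theory.
Import numFieldNormedType.Exports.
Local Open Scope classical_set_scope.
Local Open Scope ring_scope.

(** Write p = n - alpha > 0 and let A be the exceptional set.  At a point x of A
    the potential of xi^- is at least that of xi^+.

    Far from the origin this leaves only a local cause.  A centred ball of
    radius k carries more than xi^-(R^n) of the mass of xi^+, so the potential
    of xi^+ at x is at least M (|x| + k)^-p with M > m := xi^-(R^n).  The part of
    xi^- in that ball contributes at most m (|x| - k)^-p, and the part outside
    it whose distance to x is at least |x| / 2 contributes a tail mass, as small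
    as desired, times (|x| / 2)^-p.  As (|x| - k) / (|x| + k) tends to 1, these
    two contributions stay below M (|x| + k)^-p by a fixed multiple of |x|^-p.
    Hence the mass of xi^- within |x| / 2 of x must have potential at least
    c |x|^-p at x, for some constant c > 0 ([near_field_lower_bound]).

    Now let x range over A in the j-th annulus.  The mass within |x| / 2 of x
    lies in a shell S_j comparable to that annulus, so the potential of the
    restriction of xi^- to S_j is at least of order q^(-jp) on this part of A.
    A set on which the potential of a finite measure sigma is at least t has
    capacity at most a constant times sigma(R^n) / t ([inner_capacity_le]), so
    the j-th term of the thinness series is at most a constant times xi^-(S_j)
    ([shell_capacity]).  The shells overlap boundedly and xi^- has finite total
    mass, so the series converges ([measure_shell_series]).  The finitely many
    remaining terms are finite: the same capacity bound applies, with sigma the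
    unit mass at the origin.

    The capacity bound is a duality argument.  Given a competitor mu of unit
    mass and energy at most s, the set B where its potential is at most 2 s has
    mu-mass at least 1/2, and the restriction of mu to B has potential at most
    3^p 2 s everywhere ([weak_maximum_principle]).  Integrating the potential of
    sigma against this restriction, and exchanging the integrals, gives
    t / 2 <= 3^p 2 s sigma(R^n).  *)

(** * The Euclidean norm *)

Section euclidean_norm.
Context {R : realType} {n : nat}.
Implicit Types x y z : 'rV[R]_n.

Lemma enorm_ge0 x : 0 <= enorm x.
Proof. exact: sqrtr_ge0. Qed.

Lemma sumsq_ge0 x : 0 <= \sum_(i < n) x ord0 i ^+ 2.
Proof. by apply: sumr_ge0 => i _; exact: sqr_ge0. Qed.

Lemma sqr_enorm x : enorm x ^+ 2 = \sum_(i < n) x ord0 i ^+ 2.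
Proof. by rewrite sqr_sqrtr// sumsq_ge0. Qed.

Lemma enorm_eq0 x : (enorm x == 0) = (x == 0).
Proof.
rewrite sqrtr_eq0 le_eqVlt ltNge sumsq_ge0 orbF psumr_eq0; last first.
  by move=> i _; exact: sqr_ge0.
apply/allP/eqP => [x0|-> i _]; last by rewrite mxE expr0n /=.
apply/rowP => i; rewrite mxE; apply/eqP; rewrite -sqrf_eq0.
exact: x0 (mem_index_enum _).
Qed.

Lemma enormN x : enorm (- x) = enorm x.
Proof. by rewrite /enorm; under eq_bigr do rewrite mxE sqrrN. Qed.

Lemma enorm_distC x y : enorm (x - y) = enorm (y - x).
Proof. by rewrite -enormN opprB. Qed.

Lemma ler_enormD x y : enorm (x + y) <= enorm x + enorm y.
Proof.
have [/eqP|x0] := eqVneq (enorm x) 0.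
  by rewrite enorm_eq0 => /eqP ->; rewrite add0r lerDr enorm_ge0.
have [/eqP|y0] := eqVneq (enorm y) 0.
  by rewrite enorm_eq0 => /eqP ->; rewrite addr0 lerDl enorm_ge0.
have s0 : 0 < enorm x by rewrite lt_def x0 enorm_ge0.
have t0 : 0 < enorm y by rewrite lt_def y0 enorm_ge0.
rewrite -ler_sqr ?nnegrE ?addr_ge0 ?enorm_ge0// sqr_enorm.
set s := enorm x in s0 x0 *; set t := enorm y in t0 y0 *.
(* convexity of the square, with the weights s / (s + t) and t / (s + t) *)
apply: (@le_trans _ _ (\sum_(i < n)
    ((s + t) / s * x ord0 i ^+ 2 + (s + t) / t * y ord0 i ^+ 2))).
  apply: ler_sum => i _; rewrite mxE -subr_ge0.
  have -> : (s + t) / s * x ord0 i ^+ 2 + (s + t) / t * y ord0 i ^+ 2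
            - (x ord0 i + y ord0 i) ^+ 2 =
            (t * x ord0 i - s * y ord0 i) ^+ 2 / (s * t).
    by field; rewrite x0 y0.
  by rewrite divr_ge0 ?sqr_ge0// mulr_ge0 ?ltW.
rewrite big_split/= -!mulr_sumr -!sqr_enorm -/s -/t.
have -> : (s + t) / s * s ^+ 2 + (s + t) / t * t ^+ 2 = (s + t) ^+ 2.
  by field; rewrite x0 y0.
exact: lexx.
Qed.

Lemma ler_enorm_dist x y z : enorm (x - z) <= enorm (x - y) + enorm (y - z).
Proof.
by rewrite -[X in enorm X <= _](subrKA y x (- z)) ler_enormD.
Qed.

Lemma ler_enormB x y : enorm x - enorm y <= enorm (x - y).
Proof. by rewrite lerBlDr -[X in enorm X <= _](subrK y) ler_enormD. Qed.

End euclidean_norm.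

(** * Radial profile and measurability of the Riesz kernel *)

Section radial_kernel.
Context {R : realType}.
Implicit Types p r s c : R.
Local Open Scope ereal_scope.

(** Separating the profile from the distance turns comparisons of kernel values
    into comparisons of real numbers, with the diagonal included as r = 0. *)
Definition radial p r : \bar R := if r == 0%R then +oo else (r `^ (- p))%:E.

Lemma radial_ge0 p r : 0 <= radial p r.
Proof. by rewrite /radial; case: ifP => // _; rewrite lee_fin powR_ge0. Qed.

Lemma radialE p r : (0 < r)%R -> radial p r = (r `^ (- p))%:E.
Proof. by move=> r0; rewrite /radial gt_eqF. Qed.

Lemma le_radial p r s : (0 <= p)%R -> (0 <= r)%R -> (r <= s)%R ->
  radial p s <= radial p r.
Proof.
move=> p0 r0 rs; have [->|rN0] := eqVneq r 0%R; first by rewrite /radial eqxx leey.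
have {}r0 : (0 < r)%R by rewrite lt_def rN0.
have s0 := lt_le_trans r0 rs.
rewrite !radialE// lee_fin !powRN lef_pV2 ?posrE ?powR_gt0//.
by rewrite ge0_ler_powR// nnegrE ltW.
Qed.

(** Both sides are +oo at r = 0, so changes of scale need no case distinction on
    the diagonal. *)
Lemma radialM p c r : (0 < c)%R -> (0 <= r)%R ->
  radial p r = (c `^ p)%:E * radial p (c * r).
Proof.
move=> c0; rewrite le_eqVlt => /orP[/eqP <-|r0].
  by rewrite mulr0 /radial eqxx gt0_muley// lte_fin powR_gt0.
rewrite !radialE ?mulr_gt0// powRM ?(ltW c0) ?(ltW r0)// -EFinM mulrA.
by rewrite (powRN c) mulfV ?mul1r// gt_eqF// powR_gt0.
Qed.

Lemma ler_powRN_scale p c r s : (0 <= p)%R -> (0 < c)%R -> (0 < s)%R ->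
  (c * s <= r)%R -> (r `^ (- p) <= c^-1 `^ p * s `^ (- p))%R.
Proof.
move=> p0 c0 s0 csr; have cs0 : (0 < c * s)%R by rewrite mulr_gt0.
rewrite -powR_inv1 ?(ltW c0)// -powRrM mulN1r -powRM ?(ltW c0) ?(ltW s0)// !powRN.
rewrite lef_pV2 ?posrE ?powR_gt0 ?(lt_le_trans cs0)//.
by rewrite ge0_ler_powR// nnegrE ltW// (lt_le_trans cs0 csr).
Qed.

Lemma measurable_radial p : measurable_fun setT (radial p).
Proof.
apply: measurable_fun_ifT => //.
- apply: (measurable_fun_bool true).
  by rewrite setTI (_ : _ @^-1` _ = [set 0%R])//; apply/seteqP; split => x /=; move/eqP.
- by apply/measurable_EFinP; exact: measurable_powR.
Qed.

End radial_kernel.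

Section kernel.
Context {R : realType} {n : nat} (alpha : R).
Implicit Types x y z : 'rV[R]_n.
Local Notation p := (n%:R - alpha).
Local Open Scope ereal_scope.

Lemma riesz_kernelE x y : riesz_kernel alpha x y = radial p (enorm (x - y)).
Proof. by rewrite /riesz_kernel /radial enorm_eq0 subr_eq0 opprB. Qed.

Lemma riesz_kernel_ge0 x y : 0 <= riesz_kernel alpha x y.
Proof. by rewrite riesz_kernelE radial_ge0. Qed.

Lemma riesz_kernelC x y : riesz_kernel alpha x y = riesz_kernel alpha y x.
Proof. by rewrite !riesz_kernelE enorm_distC. Qed.

(** Coordinates are continuous, and every Borel measurability below reduces to
    them. *)
Lemma measurable_coord i :
  measurable_fun setT (fun x : borelRn R n => (x : 'rV[R]_n) ord0 i).
Proof.
apply: (measurability _ (RGenOpens.measurableE R)).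
move=> _ [_ [a [b ->] <-]]; rewrite setTI; apply: sub_sigma_algebra.
have /continuousP := @coord_continuous R 1 n ord0 i.
by apply; exact: interval_open.
Qed.

Lemma measurable_enorm_dist : measurable_fun setT
  (fun z : borelRn R n * borelRn R n => enorm ((z.1 : 'rV[R]_n) - z.2)).
Proof.
rewrite /enorm; apply: (@measurableT_comp _ _ _ _ _ _ (@Num.sqrt R)).
  apply: continuous_measurable_fun; exact: sqrt_continuous.
apply: measurable_sum => i.
rewrite (_ : (fun _ => _) = fun z : borelRn R n * borelRn R n => (
    ((z.1 : 'rV[R]_n) ord0 i - (z.2 : 'rV[R]_n) ord0 i) ^+ 2)%R); last first.
  by apply/funext => z; rewrite !mxE.
apply: measurable_funX; apply: measurable_funB.
- exact: (measurableT_comp (measurable_coord i) measurable_fst).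
- exact: (measurableT_comp (measurable_coord i) measurable_snd).
Qed.

Lemma measurable_riesz_kernel : measurable_fun setT
  (fun z : borelRn R n * borelRn R n => riesz_kernel alpha (z.1 : 'rV[R]_n) z.2).
Proof.
under eq_fun do rewrite riesz_kernelE.
exact: (measurableT_comp (measurable_radial p) measurable_enorm_dist).
Qed.

Lemma measurable_riesz_kernelr x :
  measurable_fun setT (fun y : borelRn R n => riesz_kernel alpha x y).
Proof.
exact: (measurableT_comp measurable_riesz_kernel
  (@measurable_pair1 _ _ (borelRn R n) (borelRn R n) x)).
Qed.

Lemma measurable_dist x : measurable_fun setT
  (fun y : borelRn R n => enorm (x - (y : 'rV[R]_n))).
Proof.
exact: (measurableT_comp measurable_enorm_dist
  (@measurable_pair1 _ _ (borelRn R n) (borelRn R n) x)).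
Qed.

Lemma measurable_enorm :
  measurable_fun setT (fun y : borelRn R n => enorm (y : 'rV[R]_n)).
Proof.
have := measurable_dist 0%R.
by under eq_fun do rewrite enorm_distC subr0.
Qed.

End kernel.

(** * The weak maximum principle *)

Section restriction.
Context d (T : measurableType d) (R : realType).
Variables (mu : {measure set T -> \bar R}) (D : set T) (mD : measurable D).
Local Open Scope ereal_scope.

Lemma integral_mrestr (f : T -> \bar R) : measurable_fun setT f ->
  (forall x, 0 <= f x) ->
  \int[mrestr mu mD]_x f x = \int[mu]_(x in D) f x.
Proof.
move=> mf f0; rewrite (@ge0_negligible_integral _ _ _ _ setT (~` D))//.
- rewrite setTD setCK; apply: eq_measure_integral => A _ AD.
  by rewrite /= /mrestr setIidl.
- exact: measurableC.
- by rewrite /= /mrestr setICl measure0.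
Qed.

End restriction.

Section weak_maximum_principle.
Context {R : realType} {n : nat} {alpha : R} (halphan : (alpha < n%:R)%R).
Local Notation p := (n%:R - alpha)%R.
Local Open Scope ereal_scope.

Lemma potential_ge0 (mu : {measure set (borelRn R n) -> \bar R}) x :
  0 <= potential alpha mu x.
Proof. by apply: integral_ge0 => y _; exact: riesz_kernel_ge0. Qed.

Lemma riesz_kernel_dilate (x y z : 'rV[R]_n) (c : R) : (0 < c)%R ->
  (enorm (y - z) <= c * enorm (x - z))%R ->
  riesz_kernel alpha x z <= (c `^ p)%:E * riesz_kernel alpha y z.
Proof.
move=> c0 yxz; rewrite !riesz_kernelE (@radialM _ _ c)// ?enorm_ge0//.
rewrite lee_pmul2l//= ?lte_fin ?powR_gt0//.
by rewrite le_radial// ?enorm_ge0// subr_ge0 ltW.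
Qed.

Lemma measurable_far (x : 'rV[R]_n) (r : R) :
  measurable ([set z | (r <= enorm (x - z))%R] : set (borelRn R n)).
Proof.
rewrite [X in measurable X](_ : _ = (fun z => enorm (x - z)) @^-1` `[r, +oo[); last first.
  by apply/seteqP; split => z /=; rewrite in_itv/= andbT.
rewrite -[X in measurable X]setTI; apply: measurable_dist => //.
Qed.

(** Fix x outside B.  If y in B is nearest to x up to a factor 2, then
    |y - z| <= 3 |x - z| for every z in B, which compares the kernels at x and y.
    When x is a limit point of B there is no such y; but for each r > 0 a point y
    of B within r of x serves all z at distance at least r, and r tends to 0
    along the sequence 1 / (i + 1). *)
Lemma weak_maximum_principle (mu : {measure set (borelRn R n) -> \bar R})
    (B : set (borelRn R n)) (k : \bar R) :
    measurable B -> mu (~` B) = 0 -> 0 <= k ->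
    (forall x, B x -> potential alpha mu x <= k) ->
  forall x : 'rV[R]_n, potential alpha mu x <= (3 `^ p)%:E * k.
Proof.
move=> mB muB0 k0 Bk x.
have mk z := measurable_riesz_kernelr alpha z.
have far r y : B y -> (0 < r)%R -> (enorm (x - y) <= 2 * r)%R ->
    \int[mu]_(z in [set z | (r <= enorm (x - z))%R]) riesz_kernel alpha x z
      <= (3 `^ p)%:E * k.
  move=> By r0 xy.
  apply: (@le_trans _ _ (\int[mu]_(z in [set z | (r <= enorm (x - z))%R])
      ((3 `^ p)%:E * riesz_kernel alpha y z))).
    apply: ge0_le_integral => //.
    - exact: measurable_far.
    - by move=> z _; exact: riesz_kernel_ge0.
    - by apply: measurable_funTS; exact: mk.
    - by apply: measurable_funTS; apply: measurable_funeM; exact: mk.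
    - move=> z /= rz; apply: riesz_kernel_dilate => //.
      rewrite (le_trans (ler_enorm_dist y x z))// enorm_distC.
      by rewrite (le_trans (lerD xy (lexx _)))//; lra.
  rewrite ge0_integralZl//; last 3 first.
  - exact: measurable_far.
  - by apply: measurable_funTS; exact: mk.
  - by move=> z _; exact: riesz_kernel_ge0.
  rewrite lee_pmul2l//= ?lte_fin ?powR_gt0//.
  apply: (le_trans _ (Bk _ By)); apply: ge0_subset_integral => //.
  - exact: measurable_far.
  - exact: mk.
  - by move=> z _; exact: riesz_kernel_ge0.
(* mu does not charge ~` B, so any E containing B may serve as domain *)
have potB (E : set (borelRn R n)) : measurable E -> B `<=` E ->
    potential alpha mu x = \int[mu]_(z in E) riesz_kernel alpha x z.
  move=> mE BE; rewrite /potential (@ge0_negligible_integral _ _ _ _ setT (~` E))//.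
  - by rewrite setTD setCK.
  - exact: measurableC.
  - by move=> z _; exact: riesz_kernel_ge0.
  - apply: (subset_measure0 _ _ _ muB0); [exact: measurableC..|exact: subsetC].
have [Bx|nBx] := pselect (B x).
  rewrite (le_trans (Bk _ Bx))// -[leLHS]mul1e lee_wpmul2r// lee_fin.
  by rewrite -[leLHS](powRr0 3) ler_powR ?ler1n// subr_ge0 ltW.
have [[y By]|B0] := pselect (B !=set0); last first.
  rewrite (potB set0)//; first by rewrite integral_set0 mule_ge0// lee_fin powR_ge0.
  by move=> z Bz; apply: B0; exists z.
(* either x is at positive distance from B, or it is a limit point of B *)
have [[e [e0 eB]]|Be] := pselect
    (exists e, (0 < e)%R /\ forall z, B z -> (e <= enorm (x - z))%R).
  pose S := [set enorm (x - z) | z in B].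
  have Se : lbound S e by move=> _ [z Bz <-]; exact: eB.
  have S0 : S !=set0 by exists (enorm (x - y)), y.
  have infS : has_inf S by split => //; exists e.
  have d0 : (0 < inf S)%R by apply: (lt_le_trans e0); exact: lb_le_inf.
  have [_ [z Bz <-] zS] := inf_adherent d0 infS.
  rewrite (potB [set z | (inf S <= enorm (x - z))%R]).
  - by apply: (far _ z) => //; rewrite ltW//; lra.
  - exact: measurable_far.
  - by move=> w Bw /=; apply: ge_inf; [exact: infS.2|exists w].
pose F i : set (borelRn R n) := [set z | (i.+1%:R^-1 <= enorm (x - z))%R].
have FT : B `<=` \bigcup_i F i.
  move=> z Bz; have xz : (0 < enorm (x - z))%R.
    rewrite lt_def enorm_ge0 andbT enorm_eq0 subr_eq0.
    by apply: contra_notN nBx => /eqP ->.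
  have [i _ ix] := near_infty_natSinv_lt (PosNum xz).
  by exists i => //=; apply/ltW/(ix i)/leqnn.
rewrite (potB (\bigcup_i F i))//; last first.
  by apply: bigcupT_measurable => i; exact: measurable_far.
have cvgF : \int[mu]_(z in F i) riesz_kernel alpha x z @[i --> \oo] -->
     \int[mu]_(z in \bigcup_i F i) riesz_kernel alpha x z.
  apply: ge0_nondecreasing_set_cvg_integral.
  - apply/nondecreasing_seqP => i; apply/subsetPset => z /=; apply: le_trans.
    by rewrite lef_pV2 ?posrE// ler_nat.
  - by move=> i; exact: measurable_far.
  - by move=> i; apply: measurable_funTS; exact: mk.
  - by move=> i z _; exact: riesz_kernel_ge0.
rewrite -(cvg_lim _ cvgF)//; apply: lime_le; first exact: (cvgP _ cvgF).
apply: nearW => i.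
have [z Bz xz] : exists2 z, B z & (enorm (x - z) < i.+1%:R^-1)%R.
  apply: contrapT => nB; apply: Be; exists (i.+1%:R^-1)%R; split => // z Bz.
  by rewrite leNgt; apply/negP => xz; apply: nB; exists z.
by apply: (far _ z) => //; rewrite (le_trans (ltW xz))// ler_peMl ?ler1n.
Qed.

End weak_maximum_principle.

(** * Capacity of a set where a potential is large *)

Section finite_measure_of.
Context d (T : measurableType d) (R : realType).
Variables (mu : {measure set T -> \bar R}) (mufin : fin_num_fun mu).

(** An alias convertible to mu: it gives mu the structure of a finite measure
    without changing its integrals, so facts about it are facts about mu. *)
Definition finite_measure_of of fin_num_fun mu : set T -> \bar R := mu.

HB.instance Definition _ := Measure.on (finite_measure_of mufin).
HB.instance Definition _ :=
  Measure_isFinite.Build _ _ _ (finite_measure_of mufin) mufin.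

End finite_measure_of.
Arguments finite_measure_of {d T R mu}.

Section capacity.
Context {R : realType} {n : nat} {alpha : R} (halphan : (alpha < n%:R)%R).
Local Notation p := (n%:R - alpha)%R.
Local Open Scope ereal_scope.

Let kernel2 (z : borelRn R n * borelRn R n) : \bar R :=
  riesz_kernel alpha (z.1 : 'rV[R]_n) z.2.

Let kernel2_ge0 z : 0 <= kernel2 z.
Proof. exact: riesz_kernel_ge0. Qed.

Let measurable_kernel2 : measurable_fun setT kernel2.
Proof. exact: measurable_riesz_kernel. Qed.

Let potentialE (mu : {measure set (borelRn R n) -> \bar R}) :
  potential alpha mu = fubini_F mu kernel2.
Proof. by []. Qed.

Lemma measurable_potential (mu : {finite_measure set (borelRn R n) -> \bar R}) :
  measurable_fun [set: borelRn R n] (potential alpha mu).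
Proof.
rewrite potentialE.
exact: (measurable_fun_fubini_tonelli_F (m2 := mu) kernel2
  measurable_kernel2 kernel2_ge0).
Qed.

Lemma potential_exchange (mu nu : {finite_measure set (borelRn R n) -> \bar R}) :
  \int[mu]_x potential alpha nu x = \int[nu]_y potential alpha mu y.
Proof.
rewrite potentialE (fubini_tonelli (m1 := mu) (m2 := nu) kernel2
  measurable_kernel2 kernel2_ge0).
by apply: eq_integral => y _; apply: eq_integral => x _; exact: riesz_kernelC.
Qed.

Lemma energyE (mu : {finite_measure set (borelRn R n) -> \bar R}) :
  energy alpha mu = \int[mu]_x potential alpha mu x.
Proof.
rewrite potentialE.
exact: (fubini_tonelli1 (m1 := mu) (m2 := mu) kernel2 measurable_kernel2 kernel2_ge0).
Qed.

Lemma energy_ge0 (mu : {measure set (borelRn R n) -> \bar R}) :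
  mu setT < +oo -> 0 <= energy alpha mu.
Proof.
move=> /lty_fin_num_fun mufin.
rewrite [leRHS](energyE (finite_measure_of mufin)).
by apply: integral_ge0 => x _; exact: potential_ge0.
Qed.

(** Cutting mu down to the set B where its potential is at most 2 s keeps half of
    the mass, by Markov's inequality, and makes the potential bounded on B, hence
    everywhere by the weak maximum principle.  Exchanging the integrals then
    tests the lower bound t against sigma.  The bound s replaces the energy so
    that a positive number is available even before the energy is known to be
    positive. *)
Lemma energy_lower_bound (sigma mu : {finite_measure set (borelRn R n) -> \bar R})
    (A : set 'rV[R]_n) (t s : R) :
    (0 <= t)%R -> (0 < s)%R ->
    (forall x, A x -> t%:E <= potential alpha sigma x) ->
    mu setT = 1 -> concentrated_on mu A -> energy alpha mu <= s%:E ->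
  t%:E <= (4 * 3 `^ p * s)%:E * sigma setT.
Proof.
move=> t0 s0 At mu1 [N [mN muN0 AN]]; rewrite energyE => es.
pose B : set (borelRn R n) := [set x | potential alpha mu x <= (2 * s)%:E].
have mB : measurable B.
  rewrite -[X in measurable X]setTI.
  exact: (emeasurable_fun_infty_c measurableT (measurable_potential mu)).
have muBC : mu (~` B) <= (2^-1)%:E.
  rewrite -(@lee_pmul2l _ (2 * s)%:E)//; last by rewrite lte_fin mulr_gt0.
  rewrite -integral_cst; last exact: measurableC.
  rewrite -EFinM mulrAC divff// mul1r; apply: le_trans es.
  apply: (@le_trans _ _ (\int[mu]_(x in ~` B) potential alpha mu x)).
    apply: ge0_le_integral => //.
    - exact: measurableC.
    - by move=> x _; rewrite lee_fin mulr_ge0// ltW.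
    - by apply: measurable_funTS; exact: measurable_potential.
    - by move=> x /negP; rewrite -ltNge => /ltW.
  apply: ge0_subset_integral => //; first exact: measurableC.
  - exact: measurable_potential.
  - by move=> x _; exact: potential_ge0.
have muB : (2^-1)%:E <= mu B.
  have : mu B + mu (~` B) = 1.
    by rewrite -mu1 -[in RHS](setUv B) measureU//; [exact: measurableC|exact: setICr].
  have muBfin := fin_num_measure mu _ mB.
  have muCfin := fin_num_measure mu _ (measurableC mB).
  rewrite -(fineK muBfin) in muBC *; rewrite -(fineK muCfin) in muBC *.
  by rewrite -EFinD lee_fin in muBC * => -[]; rewrite lee_fin; lra.
pose muB' : {finite_measure set (borelRn R n) -> \bar R} := mrestr mu mB.
have lower : (t / 2)%:E <= \int[muB']_x potential alpha sigma x.
  apply: (@le_trans _ _ (\int[muB']_(x in ~` N) potential alpha sigma x)); last first.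
    apply: ge0_subset_integral => //; first exact: measurableC.
    - exact: measurable_potential.
    - by move=> x _; exact: potential_ge0.
  apply: (@le_trans _ _ (\int[muB']_(x in ~` N) t%:E)); last first.
    apply: ge0_le_integral => //.
    - exact: measurableC.
    - by apply: measurable_funTS; exact: measurable_potential.
    - by move=> x Nx; apply: At; apply: contrapT => nAx; exact/Nx/AN.
  rewrite integral_cst; last exact: measurableC.
  rewrite EFinM lee_wpmul2l ?lee_fin//= /mrestr.
  rewrite (le_trans muB)// setIC -setDE measureD//; last first.
    by rewrite ltey_eq fin_num_measure.
  rewrite [X in _ - X](_ : _ = 0) ?sube0//.
  by apply: (subset_measure0 _ _ _ muN0) => //; exact: measurableI.
have upper y : potential alpha muB' y <= (3 `^ p * (2 * s))%:E.
  rewrite EFinM; apply: (weak_maximum_principle _ _ B) => //.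
  - by rewrite /= /mrestr setICl measure0.
  - by rewrite lee_fin mulr_ge0// ltW.
  - move=> x Bx; apply: le_trans Bx.
    rewrite /potential integral_mrestr; last 2 first.
    + exact: measurable_riesz_kernelr.
    + by move=> z; exact: riesz_kernel_ge0.
    apply: ge0_subset_integral; [exact: mB|exact: measurableT| | |].
    + exact: measurable_riesz_kernelr.
    + by move=> z _; exact: riesz_kernel_ge0.
    + exact: subsetT.
have : (t / 2)%:E <= (3 `^ p * (2 * s))%:E * sigma setT.
  apply: (le_trans lower); rewrite potential_exchange -integral_cst//.
  apply: ge0_le_integral => //.
  - by move=> y _; exact: potential_ge0.
  - exact: measurable_potential.
rewrite -(@fineK _ (sigma setT)) ?fin_num_measure// -!EFinM !lee_fin; lra.
Qed.

(** The energy estimate, passed to the infimum over all competitors.  When sigma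
    is zero it leaves no competitor at all, and the capacity vanishes. *)
Lemma inner_capacity_le (sigma : {finite_measure set (borelRn R n) -> \bar R})
    (A : set 'rV[R]_n) (t : R) :
    (0 < t)%R -> (forall x, A x -> t%:E <= potential alpha sigma x) ->
  inner_capacity alpha A <= (4 * 3 `^ p / t)%:E * sigma setT.
Proof.
move=> t0 At.
have sfin : sigma setT \is a fin_num by rewrite fin_num_measure.
set K := (4 * 3 `^ p)%R; have K0 : (0 < K)%R by rewrite mulr_gt0// powR_gt0.
set S := fine (sigma setT); have S0 : (0 <= S)%R by rewrite fine_ge0.
(* the estimate for s slightly above the energy; the choice of the slack makes
   its contribution smaller than eps *)
have key e : [set e | exists mu : {measure set (borelRn R n) -> \bar R},
       [/\ frakEplus alpha A mu, mu setT = 1 & e = energy alpha mu]] e ->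
    (t / K)%:E <= e * S%:E.
  move=> [mu [[_ muA efin] mu1 ->]] {e}.
  have mufin : fin_num_fun mu.
    by apply: lty_fin_num_fun; rewrite mu1 ltry.
  pose mu' : {finite_measure set (borelRn R n) -> \bar R} := finite_measure_of mufin.
  have e0 : 0 <= energy alpha mu by apply: energy_ge0; rewrite mu1 ltry.
  have efin' : energy alpha mu \is a fin_num by rewrite ge0_fin_numE.
  have es := fine_ge0 e0.
  rewrite -(fineK efin') -EFinM lee_fin.
  apply/ler_addgt0Pr => eps eps0.
  have S1 : (0 < S + 1)%R by lra.
  have d0 : (0 < eps / (S + 1))%R by rewrite divr_gt0.
  have := energy_lower_bound sigma mu' A t
    (fine (energy alpha mu) + eps / (S + 1))%R (ltW t0) _ At mu1 muA.
  rewrite -/S -/K -(@fineK _ (sigma setT))// -/S -EFinM !lee_fin => ineq.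
  rewrite ler_pdivrMr// mulrC.
  have {}ineq : (t <= K * (fine (energy alpha mu) + eps / (S + 1)) * S)%R.
    apply: ineq; first by rewrite ltr_wpDl.
    by rewrite -[leLHS](fineK efin') lee_fin lerDl ltW.
  apply: (le_trans ineq); rewrite -mulrA ler_pM2l// mulrDl lerD2l.
  by rewrite mulrAC ler_pdivrMr// ler_pM2l//; lra.
rewrite -(fineK sfin) -/S /inner_capacity.
move: S0; rewrite le_eqVlt => /orP[/eqP S0|S0].
  rewrite -S0 mule0 (_ : [set _ | _] = set0) ?ereal_inf0 ?invey//.
  apply/seteqP; split => // e /key; rewrite -S0 mule0 lee_fin leNgt.
  by rewrite divr_gt0.
set I := ereal_inf _.
have : (t / (K * S))%:E <= I.
  apply: le_ereal_inf_tmp => e /key.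
  by rewrite -lee_pdivrMr// -EFinM -mulrA -invfM.
have tKS : (0 < t / (K * S))%R by rewrite divr_gt0// mulr_gt0.
case: I => [r| |]; rewrite ?leeNy_eq ?invey ?lee_fin//; last first.
  by move=> _; rewrite mulr_ge0 ?divr_ge0 ?ltW.
move=> tr; have r0 := lt_le_trans tKS tr.
rewrite inver gt_eqF// -EFinM lee_fin mulrAC.
by rewrite -[leRHS]invrK lef_pV2 ?posrE ?invr_gt0 ?divr_gt0 ?mulr_gt0// invf_div.
Qed.

End capacity.

(** * Shells and the terms of the thinness series *)

Section shells.
Context {R : realType} {n : nat} (q : R) (q1 : 1 < q).
Local Open Scope ereal_scope.

Definition shell (i w : nat) : set (borelRn R n) :=
  [set y | (q ^+ i <= enorm (y : 'rV[R]_n) < q ^+ (i + w))%R].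

Lemma measurable_shell i w : measurable (shell i w).
Proof.
rewrite [X in measurable X](_ : _ =
    (fun y : borelRn R n => enorm (y : 'rV[R]_n)) @^-1`
      `[(q ^+ i)%R, (q ^+ (i + w))%R[); last first.
  by apply/seteqP; split => y /=; rewrite in_itv.
by rewrite -[X in measurable X]setTI; apply: measurable_enorm.
Qed.

(** Shells one step wide are pairwise disjoint. *)
Lemma measure_shell1_series (sigma : {measure set (borelRn R n) -> \bar R}) w :
  \sum_(0 <= i <oo) sigma (shell (i + w) 1) <= sigma setT.
Proof.
have mS i : measurable (shell (i + w) 1) by exact: measurable_shell.
have tS : trivIset setT (fun i => shell (i + w) 1).
  have lt_disj i j : (i < j)%N -> shell (i + w) 1 `&` shell (j + w) 1 = set0.
    move=> ij; apply/seteqP; split => // y [] /= /andP[_ yi] /andP[jy _].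
    have := le_lt_trans jy yi; apply/negP; rewrite -leNgt.
    by rewrite ler_weXn2l ?ltW// addnAC leq_add2r addn1.
  apply/trivIsetP => i j _ _; rewrite neq_ltn => /orP[|] ij; first exact: lt_disj.
  by rewrite setIC lt_disj.
have -> : \sum_(0 <= i <oo) sigma (shell (i + w) 1) =
    sigma (\bigcup_i shell (i + w) 1).
  rewrite measure_bigcup//.
  by apply: eq_eseriesl => i; rewrite in_setT.
by apply: le_measure; rewrite ?inE//; exact: bigcupT_measurable.
Qed.

(** A shell of width w is the union of w shells one step wide. *)
Lemma measure_shell_series (sigma : {measure set (borelRn R n) -> \bar R}) w :
  \sum_(0 <= i <oo) sigma (shell i w) <= w%:R%:E * sigma setT.
Proof.
elim: w => [|w IH].
  rewrite mul0e eseries0// => i _ _.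
  rewrite (_ : shell i 0 = set0) ?measure0//; apply/seteqP; split => // y /=.
  by rewrite /shell /= addn0 => /andP[/le_lt_trans/[apply]]; rewrite ltxx.
apply: (@le_trans _ _ (\sum_(0 <= i <oo) (sigma (shell i w) + sigma (shell (i + w) 1)))).
  apply: lee_nneseries => // i _.
  apply: le_trans (measureU2 _ _ _); [|exact: measurable_shell..].
  apply: le_measure; rewrite ?inE; first exact: measurable_shell.
    by apply: measurableU; exact: measurable_shell.
  move=> y /= /andP[iy yi].
  have [yw|wy] := ltP (enorm (y : 'rV[R]_n)) (q ^+ (i + w))%R; [left|right].
    by rewrite /shell /= iy.
  by rewrite /shell /= wy addn1 -addnS.
rewrite nneseriesD//= -natr1 EFinD ge0_muleDl//= mul1e leeD//.
exact: measure_shell1_series.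
Qed.

End shells.

Section shell_capacity.
Context {R : realType} {n : nat} {alpha q : R}.
Context (halphan : (alpha < n%:R)%R) (q1 : (1 < q)%R).
Local Notation p := (n%:R - alpha)%R.
Local Open Scope ereal_scope.

Lemma inner_capacity_ge0 (A : set 'rV[R]_n) : 0 <= inner_capacity alpha A.
Proof.
rewrite inve_ge0; apply: le_ereal_inf_tmp => _ [mu [_ mu1 ->]].
by apply: energy_ge0; rewrite mu1 ltry.
Qed.

(** The power q^(-jp), up to constants the value of |x|^-p on the annulus, cancels
    against the weight of the thinness series.  The constant does not depend
    on j. *)
Lemma shell_capacity (sigma : {finite_measure set (borelRn R n) -> \bar R})
    (A : set 'rV[R]_n) (c : R) (j : nat) :
    (0 < c)%R ->
    (forall x, (A `&` annulus q 0%R j) x ->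
       c%:E * radial p (enorm x) <= potential alpha sigma x) ->
  inner_capacity alpha (A `&` annulus q 0%R j) / (q `^ (j%:R * p))%:E <=
  (4 * 3 `^ p * q `^ p / c)%:E * sigma setT.
Proof.
move=> c0 Aj.
have q0 : (0 < q)%R by exact: lt_trans ltr01 q1.
have p0 : (0 < p)%R by rewrite subr_gt0.
set Q := (q ^+ j)%R; have Q0 : (0 < Q)%R by rewrite exprn_gt0.
have -> : (q `^ (j%:R * p) = Q `^ p)%R by rewrite powRrM powR_mulrn// ltW.
have t0 : (0 < c * (q * Q) `^ (- p))%R by rewrite mulr_gt0// powR_gt0// mulr_gt0.
have := inner_capacity_le halphan sigma (A `&` annulus q 0%R j) _ t0.
have At x : (A `&` annulus q 0%R j) x ->
    (c * (q * Q) `^ (- p))%:E <= potential alpha sigma x.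
  move=> Ax; apply: le_trans (Aj x Ax).
  move: Ax => [_]; rewrite /annulus/= subr0 -/Q exprS -/Q => /andP[_ xQ].
  rewrite EFinM lee_pmul2l//; rewrite -radialE ?mulr_gt0//.
  by rewrite le_radial// ?enorm_ge0 ?ltW.
move=> /(_ At); rewrite inver gt_eqF ?powR_gt0//.
rewrite lee_pdivrMr ?powR_gt0// muleAC -EFinM.
congr (_ <= _); congr (_%:E * _).
rewrite powRN (powRM _ (ltW q0) (ltW Q0)); field.
by rewrite !gt_eqF// powR_gt0.
Qed.

End shell_capacity.

(** * The local cause of a large potential *)

Section centered_balls.
Context {R : realType} {n : nat}.
Local Open Scope ereal_scope.

Definition cball (k : nat) : set (borelRn R n) :=
  [set y | (enorm (y : 'rV[R]_n) <= k%:R)%R].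

Lemma measurable_cball k : measurable (cball k).
Proof.
rewrite [X in measurable X](_ : _ =
    (fun y : borelRn R n => enorm (y : 'rV[R]_n)) @^-1` `]-oo, k%:R]); last first.
  by apply/seteqP; split => y /=; rewrite in_itv.
by rewrite -[X in measurable X]setTI; apply: measurable_enorm.
Qed.

Lemma sub_cball k l : (k <= l)%N -> cball k `<=` cball l.
Proof. by move=> kl y /= /le_trans; apply; rewrite ler_nat. Qed.

Lemma le_measure_cball (mu : {measure set (borelRn R n) -> \bar R}) k l :
  (k <= l)%N -> mu (cball k) <= mu (cball l).
Proof.
move=> kl; apply: le_measure; rewrite ?inE; [exact: measurable_cball..|].
exact: sub_cball.
Qed.

Lemma cball_mass_gt (mu : {measure set (borelRn R n) -> \bar R}) (a : \bar R) :
  a < mu setT -> exists k, a < mu (cball k).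
Proof.
move=> amu; apply: contrapT => /forallNP ka; move: amu; apply/negP; rewrite -leNgt.
have -> : [set: borelRn R n] = \bigcup_k cball k.
  apply/seteqP; split => // y _.
  exists (Num.trunc (enorm (y : 'rV[R]_n))).+1 => //=.
  by rewrite /cball /= ltW// truncnS_gt.
have mb k : measurable (cball k) by exact: measurable_cball.
have cv : mu \o cball @ \oo --> mu (\bigcup_k cball k).
  apply: nondecreasing_cvg_mu => //; first exact: bigcupT_measurable.
  by move=> k l kl; apply/subsetPset; exact: sub_cball.
rewrite -(cvg_lim _ cv)//; apply: lime_le; first exact: (cvgP _ cv).
by apply: nearW => k; rewrite /= leNgt; apply/negP; exact: ka.
Qed.

Lemma cball_tail_le (mu : {measure set (borelRn R n) -> \bar R}) (e : R) :
  mu setT < +oo -> (0 < e)%R -> exists k, mu (~` cball k) <= e%:E.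
Proof.
move=> muoo e0.
have mufin := lty_fin_num_fun muoo.
have muT : mu setT \is a fin_num by exact: mufin.
have : mu setT - e%:E < mu setT by rewrite lteBlDr// lteDl// lte_fin.
move=> /cball_mass_gt[k ke]; exists k.
have mb := measurable_cball k.
rewrite -setTD measureD//= setTI leeBlDr ?mufin//.
by rewrite addeC -leeBlDr// ltW.
Qed.

End centered_balls.

Section bounds.
Context d (T : measurableType d) (R : realType).
Local Open Scope ereal_scope.

Lemma integral_le_mul (mu : {measure set T -> \bar R}) (D E : set T)
    (f : T -> \bar R) (a : R) :
    measurable D -> measurable E -> D `<=` E -> measurable_fun setT f ->
    (0 <= a)%R -> (forall x, 0 <= f x) -> (forall x, D x -> f x <= a%:E) ->
  \int[mu]_(x in D) f x <= a%:E * mu E.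
Proof.
move=> mD mE DE mf a0 f0 fa.
apply: (@le_trans _ _ (a%:E * mu D)).
  rewrite -integral_cst//; apply: ge0_le_integral => //.
  exact: measurable_funTS.
by rewrite lee_wpmul2l// le_measure ?inE.
Qed.

End bounds.

Lemma large_radius (R : realFieldType) (lam k x : R) :
    0 < lam < 1 -> 0 <= k -> (1 + lam) / (1 - lam) * k + 1 <= x ->
  [/\ k < x, lam * (x + k) <= x - k, 2^-1 * (x + k) <= x &
      4^-1 * (x + k) <= x / 2].
Proof.
move=> /andP[lam0 lam1] k0 kx.
have kl : k <= (1 + lam) / (1 - lam) * k.
  by rewrite ler_peMl// ler_pdivlMr; lra.
have k_lt_x : k < x by lra.
split=> //; [|lra..].
have : (1 + lam) / (1 - lam) * k <= x by lra.
rewrite mulrAC ler_pdivrMr; lra.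
Qed.

Section near_field.
Context {R : realType} {n : nat} {alpha : R} (halphan : (alpha < n%:R)%R).
Local Notation p := (n%:R - alpha)%R.
Local Open Scope ereal_scope.

(** All points of the ball are within |x| + k of x. *)
Lemma potential_ge_cball (mu : {measure set (borelRn R n) -> \bar R})
    (k : nat) (M : R) (x : 'rV[R]_n) :
    (0 < enorm x + k%:R)%R -> M%:E <= mu (cball k) ->
  (M * (enorm x + k%:R) `^ (- p))%:E <= potential alpha mu x.
Proof.
move=> x0 Mk; have p0 : (0 < p)%R by rewrite subr_gt0.
have mb : measurable (cball k : set (borelRn R n)) by exact: measurable_cball.
have mk := measurable_riesz_kernelr alpha x.
apply: (@le_trans _ _ (\int[mu]_(y in cball k) riesz_kernel alpha x y)); last first.
  apply: ge0_subset_integral; [exact: mb|exact: measurableT|exact: mk| |].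
  - by move=> y _; exact: riesz_kernel_ge0.
  - exact: subsetT.
apply: (@le_trans _ _ (\int[mu]_(y in cball k) ((enorm x + k%:R) `^ (- p))%:E)).
  by rewrite integral_cst// mulrC EFinM lee_wpmul2l// lee_fin powR_ge0.
apply: ge0_le_integral => //.
- by move=> y _; rewrite lee_fin powR_ge0.
- by apply: measurable_funTS; exact: mk.
- move=> y yk; rewrite riesz_kernelE -radialE//.
  apply: le_radial; rewrite ?enorm_ge0//; first exact: ltW.
  by rewrite (le_trans (ler_enormD _ _))// enormN lerD2l.
Qed.

(** Outside G, points of the ball are at distance at least |x| - k from x, and the
    remaining points are at distance at least |x| / 2. *)
Lemma potential_le_split (mu : {measure set (borelRn R n) -> \bar R})
    (k : nat) (x : 'rV[R]_n) (G : set (borelRn R n)) (m e : R) :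
    (k%:R < enorm x)%R -> mu setT <= m%:E -> mu (~` cball k) <= e%:E ->
    measurable G -> (forall y : 'rV[R]_n, (enorm (x - y) < enorm x / 2)%R -> G y) ->
  potential alpha mu x <=
    ((enorm x - k%:R) `^ (- p) * m + (enorm x / 2) `^ (- p) * e)%:E +
    \int[mu]_(y in G) riesz_kernel alpha x y.
Proof.
move=> kx mum mue mG xG; have p0 : (0 < p)%R by rewrite subr_gt0.
have x0 : (0 < enorm x)%R by rewrite (le_lt_trans _ kx).
have mb : measurable (cball k : set (borelRn R n)) by exact: measurable_cball.
have mCG := measurableC mG.
have mCb := measurableC mb.
have mk : measurable_fun setT (fun y : borelRn R n => riesz_kernel alpha x y).
  exact: measurable_riesz_kernelr.
have k0 (y : borelRn R n) : 0 <= riesz_kernel alpha x y by exact: riesz_kernel_ge0.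
rewrite addeC EFinD.
have -> : potential alpha mu x = \int[mu]_(y in G) riesz_kernel alpha x y +
   (\int[mu]_(y in ~` G `&` cball k) riesz_kernel alpha x y +
    \int[mu]_(y in ~` G `&` ~` cball k) riesz_kernel alpha x y).
  rewrite -ge0_integral_setU; first last.
  - by apply/disj_set2P; rewrite setIACA setICr setI0.
  - by move=> y _; exact: k0.
  - exact: measurable_funTS.
  - exact: measurableI.
  - exact: measurableI.
  rewrite -setIUr setUv setIT -ge0_integral_setU ?setUv//.
  exact/disj_setPCl.
rewrite leeD2l// leeD//.
- apply: (@le_trans _ _ (((enorm x - k%:R) `^ (- p))%:E * mu setT)).
    apply: integral_le_mul => //; [exact: measurableI|exact: powR_ge0|].
    move=> y [_ yk]; have d0 : (0 < enorm x - k%:R)%R by rewrite subr_gt0.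
    rewrite riesz_kernelE -radialE//; apply: le_radial; [exact: ltW..|].
    by apply: le_trans (ler_enormB _ _); rewrite lerD2l lerN2.
  by rewrite EFinM lee_wpmul2l// lee_fin powR_ge0.
- apply: (@le_trans _ _ (((enorm x / 2) `^ (- p))%:E * mu (~` cball k))).
    apply: integral_le_mul => //; [exact: measurableI|exact: powR_ge0|].
    move=> y [Gy _]; have d0 : (0 < enorm x / 2)%R by rewrite divr_gt0.
    rewrite riesz_kernelE -radialE//; apply: le_radial; [exact: ltW..|].
    by rewrite leNgt; apply/negP => /xG.
  by rewrite EFinM lee_wpmul2l// lee_fin powR_ge0.
Qed.

(** The larger mass of mu, seen from far away, wins over the central part and the
    tail of nu by a fixed proportion; where the potential of nu is nevertheless
    the larger one, the part of nu close to x has to make up the difference. *)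
Lemma near_field_lower_bound (mu nu : {measure set (borelRn R n) -> \bar R}) :
    nu setT < mu setT ->
  exists c r : R, (0 < c)%R /\ forall x : 'rV[R]_n, (r <= enorm x)%R ->
    potential alpha mu x <= potential alpha nu x ->
    forall G : set (borelRn R n), measurable G ->
      (forall y : 'rV[R]_n, (enorm (x - y) < enorm x / 2)%R -> G y) ->
    c%:E * radial p (enorm x) <= \int[nu]_(y in G) riesz_kernel alpha x y.
Proof.
move=> numu; have p0 : (0 < p)%R by rewrite subr_gt0.
have nuoo : nu setT < +oo by rewrite (lt_le_trans numu)// leey.
have nufin : nu setT \is a fin_num by rewrite ge0_fin_numE.
set m := fine (nu setT).
have m0 : (0 <= m)%R by exact: fine_ge0.
have num : nu setT = m%:E by rewrite fineK.
have [k1 mk1] : exists k, m%:E < mu (cball k) by apply: cball_mass_gt; rewrite -num.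
have [M mM Mk1] : exists2 M : R, (m < M)%R & M%:E <= mu (cball k1).
  case: (mu (cball k1)) mk1 => [r| |]//.
    by rewrite lte_fin => mr; exists r.
  by move=> _; exists (m + 1)%R; [rewrite ltrDl|exact: leey].
have M0 : (0 < M)%R by exact: le_lt_trans mM.
pose m' := ((m + M) / 2)%R.
have mm' : (m < m')%R by rewrite (midf_lt mM).
have m'M : (m' < M)%R by rewrite (midf_lt mM).
have m'0 : (0 < m')%R by exact: le_lt_trans mm'.
(* the ratio (|x| - k) / (|x| + k) exceeds lam for |x| large, and then the mass
   M > m' near the origin beats the mass m < m' *)
have mM0 : (0 < m' / M)%R by rewrite divr_gt0.
pose lam := ((m' / M) `^ (p^-1))%R.
have lamp : (lam `^ p = m' / M)%R.
  by rewrite /lam -powRrM mulVf ?gt_eqF// powRr1// ltW.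
have lam0 : (0 < lam)%R by rewrite powR_gt0.
have lam1 : (lam < 1)%R.
  have -> : (1 = 1 `^ p^-1 :> R)%R by rewrite powR1.
  rewrite gt0_ltr_powR ?invr_gt0 ?nnegrE ?(ltW mM0)//.
  by rewrite ltr_pdivrMr// mul1r.
(* what remains of M after the central part of nu is subtracted; the tail is
   allowed to use half of it *)
pose g := (M - m * M / m')%R.
have g0 : (0 < g)%R.
  by rewrite /g subr_gt0 ltr_pdivrMr// [ltRHS]mulrC ltr_pM2r.
pose e := (g / (2 * 4 `^ p))%R.
have e0 : (0 < e)%R by rewrite divr_gt0// mulr_gt0// powR_gt0.
have [k2 ek2] := cball_tail_le nu e nuoo e0.
pose k := maxn k1 k2.
have Mk : M%:E <= mu (cball k).
  by rewrite (le_trans Mk1)// le_measure_cball// leq_maxl.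
have ek : nu (~` cball k) <= e%:E.
  apply: le_trans ek2; apply: le_measure; rewrite ?inE.
  - by apply: measurableC; exact: measurable_cball.
  - by apply: measurableC; exact: measurable_cball.
  - by apply: subsetC; apply: sub_cball; exact: leq_maxr.
exists (g / 2 / 2 `^ p)%R, ((1 + lam) / (1 - lam) * k%:R + 1)%R.
split; first by rewrite !divr_gt0// powR_gt0.
move=> x xr bad G mG xG.
have k0 : (0 <= k%:R :> R)%R by [].
have [kx lams s2x s4x] : [/\ (k%:R < enorm x)%R,
    (lam * (enorm x + k%:R) <= enorm x - k%:R)%R,
    (2^-1 * (enorm x + k%:R) <= enorm x)%R &
    (4^-1 * (enorm x + k%:R) <= enorm x / 2)%R].
  by apply: large_radius => //; rewrite lam0.
have x0 : (0 < enorm x)%R by exact: le_lt_trans kx.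
set s := (enorm x + k%:R)%R in lams s2x s4x *.
have s0 : (0 < s)%R by rewrite ltr_wpDr.
have num_le : nu setT <= m%:E by rewrite num.
have lower := potential_ge_cball mu k M x s0 Mk.
have upper := potential_le_split nu k x G m e kx num_le ek mG xG.
have := le_trans lower (le_trans bad upper).
rewrite -/s; set I := \int[_]_(y in _) _.
set P := (s `^ (- p))%R => ineq.
have P0 : (0 < P)%R by rewrite powR_gt0.
(* each term is compared with the common power P *)
have nearP : ((enorm x - k%:R) `^ (- p) <= (M / m') * P)%R.
  apply: le_trans (ler_powRN_scale p lam _ s _ _ _ lams) _; rewrite ?(ltW p0)//.
  by rewrite -(powR_inv1 (ltW lam0)) -powRrM mulN1r (powRN lam) lamp invf_div.
have farP : ((enorm x / 2) `^ (- p) <= 4 `^ p * P)%R.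
  have := ler_powRN_scale p _ _ s (ltW p0) _ s0 s4x.
  by rewrite invrK; apply; rewrite invr_gt0.
have xP : (enorm x `^ (- p) <= 2 `^ p * P)%R.
  have := ler_powRN_scale p _ _ s (ltW p0) _ s0 s2x.
  by rewrite invrK; apply; rewrite invr_gt0.
apply: (@le_trans _ _ (g / 2 * P)%:E).
  rewrite radialE// -EFinM lee_fin -(mulrA (g / 2)%R) ler_pM2l ?divr_gt0//.
  by rewrite mulrC ler_pdivrMr ?powR_gt0// mulrC.
have : (M * P)%:E <= ((M / m') * P * m + 4 `^ p * P * e)%:E + I.
  by rewrite (le_trans ineq)// leeD2r// lee_fin lerD// ler_wpM2r// ltW.
have -> : ((M / m') * P * m + 4 `^ p * P * e = (M - g) * P + g / 2 * P)%R.
  rewrite /e /g; field.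
  by rewrite !gt_eqF ?powR_gt0.
move: I {ineq} => [i| |]; rewrite ?leey//.
rewrite -EFinD !lee_fin; clear; lra.
Qed.

End near_field.

(** * Thinness of the exceptional set *)

Lemma exists_expr_ge (R : realType) (q a : R) : 1 < q ->
  exists N : nat, a <= q ^+ N.
Proof.
move=> q1; have q0 : 0 < q by exact: lt_trans q1.
have [a0|a0] := leP a 0; first by exists 0%N; rewrite (le_trans a0).
have qV : `|q^-1| < 1 by rewrite ger0_norm ?invr_ge0 ?ltW// invf_lt1.
have a'0 : 0 < a^-1 by rewrite invr_gt0.
have := cvg_expr qV => /cvgr0Pnorm_lt /(_ _ a'0)[N _ /(_ N (leqnn _))] /=.
rewrite ger0_norm ?exprn_ge0 ?invr_ge0 ?(ltW q0)// exprVn => h.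
by exists N; rewrite -lef_pV2 ?posrE ?exprn_gt0// ltW.
Qed.

Theorem corollary1p7 (R : realType) (n : nat) (alpha q : R)
    (hn : (2 <= n)%N) (halpha : 0 < alpha <= 2) (halphan : alpha < n%:R)
    (hq : 1 < q)
    (xi : set (borelRn R n) -> R)
    (xip xim : {measure set (borelRn R n) -> \bar R})
    (hxi : frakM alpha xi xip xim)
    (hmass : (xim [set: 'rV[R]_n] < xip [set: 'rV[R]_n])%E) :
  inner_thin_at_infinity alpha q
    [set x : 'rV[R]_n | ~ signed_potential_gt0 alpha xip xim x].
Proof.
set A := [set x | _]; set p := n%:R - alpha.
have p0 : 0 < p by rewrite subr_gt0.
have q0 : 0 < q by exact: lt_trans hq.
have bad (x : 'rV[R]_n) : A x -> (potential alpha xip x <= potential alpha xim x)%E.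
  move=> Ax; rewrite leNgt; apply/negP => lt_pot; apply: Ax; split.
    rewrite fin_num_adde_defl// fin_numN ge0_fin_numE ?potential_ge0//.
    by rewrite (lt_le_trans lt_pot)// leey.
  by rewrite sube_gt0.
have [c [r [c0 near]]] := near_field_lower_bound halphan xip xim hmass.
(* q ^ J exceeds the radius beyond which the local bound holds, and absorbs the
   factor 2 by which distances vary within |x| / 2 of x *)
have [J rJ] := exists_expr_ge R q (Num.max r 2) hq.
have {rJ} [rJ J2] : r <= q ^+ J /\ 2 <= q ^+ J by move: rJ; rewrite ge_max => /andP.
have ximoo : (xim setT < +oo)%E by rewrite (lt_le_trans hmass)// leey.
have ximfin := lty_fin_num_fun ximoo.
exists 0.
pose C (b : R) := (4 * 3 `^ p * q `^ p / b)%:E.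
have C0 b : 0 < b -> (0 <= C b)%E.
  by move=> b0; rewrite lee_fin divr_ge0 ?ltW// !mulr_gt0// powR_gt0.
pose u (j : nat) : \bar R :=
  (inner_capacity alpha (A `&` annulus q 0 j) / (q `^ (j%:R * p))%:E)%E.
change (\sum_(0 <= j <oo) u j < +oo)%E.
have u0 j : (0 <= u j)%E.
  by rewrite mule_ge0 ?inner_capacity_ge0// inve_ge0 lee_fin powR_ge0.
(* each single term is finite, by comparison with the unit mass at 0 *)
have u_fin j : (u j < +oo)%E.
  pose d0 : {finite_measure set (borelRn R n) -> \bar R} := @dirac _ (borelRn R n) 0 R.
  have := shell_capacity halphan hq d0 A 1 j ltr01.
  rewrite -/p => /(_ _)/le_lt_trans; apply.
    move=> x _; rewrite /potential /d0/= integral_dirac//.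
      2: exact: measurable_riesz_kernelr.
    by rewrite diracT !mul1e riesz_kernelE subr0.
  by rewrite -ge0_fin_numE ?mule_ge0 ?C0// fin_numM// fin_num_measure.
have u_far i : (u (i + J)%N <= C c * xim (shell q i (J + J).+1))%E.
  have mS : measurable (shell q i (J + J).+1 : set (borelRn R n)).
    exact: measurable_shell.
  pose nu : {finite_measure set (borelRn R n) -> \bar R} :=
    mrestr (finite_measure_of ximfin) mS.
  have := shell_capacity halphan hq nu A c (i + J)%N c0.
  rewrite -/p [nu setT](_ : _ = xim (shell q i (J + J).+1)); last first.
    by rewrite /nu /= /mrestr setTI.
  apply => x [Ax]; rewrite /annulus /= subr0 => /andP[jx xj].
  rewrite /potential integral_mrestr; last 2 first.
  - exact: measurable_riesz_kernelr.
  - by move=> y; exact: riesz_kernel_ge0.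
  have Jx : q ^+ J <= enorm x.
    by rewrite (le_trans _ jx)// ler_weXn2l ?ltW// leq_addl.
  have x0 : 0 < enorm x by rewrite (lt_le_trans _ Jx)// exprn_gt0.
  apply: near; [exact: le_trans Jx|exact: bad|exact: mS|].
  (* |x| / 2 < |y| < 2 |x|, and the factor 2 is at most q ^ J *)
  move=> y xy; have y2 : enorm x / 2 < enorm y.
    by have := ler_enormB x y; lra.
  have y_lt : enorm y < 2 * enorm x.
    by have := ler_enormB y x; rewrite enorm_distC; lra.
  apply/andP; split.
    rewrite -(ler_pM2r (exprn_gt0 J q0)) -exprD (le_trans jx)//.
    have := ler_wpM2l (enorm_ge0 y) J2; lra.
  apply: (lt_le_trans y_lt); rewrite addnS addnA -addSn exprD mulrC.
  by apply: ler_pM => //; rewrite ?enorm_ge0// ltW.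
have Jsplit : (\sum_(0 <= j <oo) u j =
    \sum_(0 <= j < J) u j + \sum_(i <oo) u (i + J)%N)%E.
  rewrite (@nneseries_split _ u 0 J) => [|j _]; last exact: u0.
  by rewrite add0n (nneseries_addn J u0).
rewrite Jsplit lte_add_pinfty//.
  by apply: lte_sum_pinfty => j _; exact: u_fin.
apply: (@le_lt_trans _ _ (C c * ((J + J).+1%:R%:E * xim setT))%E).
  apply: (@le_trans _ _ (\sum_(i <oo) (C c * xim (shell q i (J + J).+1)))%E).
    exact: lee_nneseries.
  rewrite nneseriesZl//.
  apply: lee_wpmul2l; first exact: C0.
  exact: (measure_shell_series q hq).
by rewrite -ge0_fin_numE ?mule_ge0 ?C0// !fin_numM// ximfin.
Qed.
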